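(* Let $w$ be a quasi-Coxeter element in a finite dual Coxeter system $(W,T)$ of rank $n$ and let $(t_1,\dots,t_n)\in\mathrm{Red}_T(w)$ be such that $W=\langle t_1,\dots,t_n\rangle$. Then the reflection subgroup $W':=\langle t_1,\dots,t_{n-1}\rangle$ is parabolic.
   Context: A dual Coxeter system $(W,T)$ of (finite) rank $n$ consists of a group $W$ and a subset $T\subseteq W$ such that there is a subset $S\subseteq T$ with $|S|=n$, $(W,S)$ a Coxeter system, and $T=\{wsw^{-1}\mid w\in W, s\in S\}$; it is finite if $W$ is finite. Elements of $T$ are called reflections; a reflection subgroup is a subgroup generated by reflections. A simple system for $(W,T)$ is any subset $S'\subseteq T$ such that $(W,S')$ is a Coxeter system; all simple systems have the same cardinality $n$. A subgroup of $W$ is called parabolic for $(W,T)$ if it is of the form $\langle s_1,\dots,s_m\rangle$ for some simple system $\{s_1,\dots,s_n\}$ for $(W,T)$ and some $m\le n$. For $w\in W$, $\mathrm{Red}_T(w)$ denotes the set of all tuples $(t_1,\dots,t_m)\in T^m$ with $w=t_1\cdots t_m$ and $m$ minimal. An element $w\in W$ is a quasi-Coxeter element for $(W,T)$ if there exists $(t_1,\dots,t_n)\in\mathrm{Red}_T(w)$ such that $W=\langle t_1,\dots,t_n\rangle$. *)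

(* Defs.v *)
From HB Require Import structures.
From mathcomp Require Import all_boot all_fingroup.

Set Implicit Arguments.
Unset Strict Implicit.
Unset Printing Implicit Defensive.

Local Open Scope group_scope.

(* (W, S) is a Coxeter system: S consists of involutions and W has the        *)
(* presentation < S | (s t)^m(s,t) = 1 >, where m(s,t) is the order of s t.   *)
(* The presentation is expressed by its universal property; uniqueness of     *)
(* phi on W is automatic since S generates W. The target group H is arbitrary *)
(* (possibly infinite).                                                       *)
Definition coxeter_system (gT : finGroupType) (W : {group gT})
    (S : {set gT}) : Prop :=
  [/\ {in S, forall s, #[s] = 2},
      <<S>> = W
    & forall (H : groupType) (f : gT -> H),
        {in S &, forall s t, (f s * f t) ^+ #[s * t] = 1} ->
        exists phi : gT -> H,
          {in W &, {morph phi : x y / x * y}} /\ {in S, phi =1 f}].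

Definition dual_coxeter_system (gT : finGroupType) (W : {group gT})
    (T : {set gT}) (n : nat) : Prop :=
  exists S : {set gT},
    [/\ S \subset T, #|S| = n, coxeter_system W S & T = class_support S W].

Definition simple_system (gT : finGroupType) (W : {group gT})
    (T S : {set gT}) : Prop :=
  S \subset T /\ coxeter_system W S.

Definition parabolic (gT : finGroupType) (W : {group gT})
    (T P : {set gT}) : Prop :=
  exists (s : seq gT) (m : nat),
    [/\ uniq s, simple_system W T [set x in s], m <= size s
      & P = <<[set x in take m s]>>].

Definition factorization (gT : finGroupType) (T : {set gT}) (w : gT)
    (ts : seq gT) : Prop :=
  {subset ts <= T} /\ \prod_(t <- ts) t = w.

Definition Red (gT : finGroupType) (T : {set gT}) (w : gT)
    (ts : seq gT) : Prop :=
  factorization T w ts /\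
  forall us : seq gT, factorization T w us -> size ts <= size us.

Definition quasi_coxeter (gT : finGroupType) (W : {group gT})
    (T : {set gT}) (n : nat) (w : gT) : Prop :=
  w \in W /\
  exists t : n.-tuple gT, Red T w t /\ <<[set x in t]>> = W.

(* Main.v *)
(* Let N(w) be the set of reflections inverted by w. It is a cocycle,         *)

(* In this outline [nu w t] stands for t being in N(w); for a reflection t it means that [t * w] is
   shorter than w. The cocycle comes from [inversion_cocycle_ex], the proper parabolic subgroup from
   [refls_sub_parabolic], Dyer's generation from [gen_chi], the dihedral bound from
   [card_chi_rank2]. [pairwise_canonical_simple] recognizes S, and [chi_simple] joins the last three
   around a reflection of minimal length. *)
(* obtained from the universal property by letting W act on pairs             *)
(* (reflection, sign). For a reflection subgroup G, the set chi G of all q in *)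
(* G with N(q) :&: G = {q} generates G (Dyer). Call a set X of reflections    *)
(* canonical if N(x) :&: <<X>> = {x} for all x in X.                          *)
(*   n - 1 reflections lie in a proper parabolic subgroup, so after changing  *)
(* the simple system S we may assume W' is inside <<K>> with K proper in S.   *)
(* Among the reflections t with <W', t> = W take one of minimal S-length. For *)
(* g in chi W' put D = <g, t>. As D is dihedral, chi D has at most two        *)
(* elements; g is one of them because it is the only reflection of D in       *)
(* <<K>>, and by minimality t is the other. So any two elements of            *)
(* t |: chi W' form a canonical set, and a generating set of reflections of W *)
(* with this property equals S. Hence W' = <<chi W'>> is generated by a       *)
(* subset of S.                                                               *)
Require Import Defs.
From mathcomp Require Import all_boot all_fingroup all_solvable.
Set Implicit Arguments.
Unset Strict Implicit.
Unset Printing Implicit Defensive.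
Local Open Scope group_scope.

(** * Word length *)

Section WordLength.
Variables (gT : finGroupType) (X : {set gT}).
Implicit Types (s : seq gT) (g h x : gT).

Lemma mem_prod_word s : {subset s <= X} -> \prod_(x <- s) x \in <<X>>.
Proof.
move=> sX; rewrite big_seq; apply: group_prod => x xs.
exact/mem_gen/sX.
Qed.

Lemma gen_wordP g :
  g \in <<X>> -> exists2 s, {subset s <= X} & \prod_(x <- s) x = g.
Proof.
case/gen_prodgP=> n [c cX ->]; exists [seq c i | i <- enum 'I_n].
  by move=> _ /mapP[i _ ->].
by rewrite big_map enumT.
Qed.

Fact word_size_ex g :
  exists k, [exists s : k.-tuple gT,
    all [in X] s && (\prod_(x <- s) x == g)] || (g \notin <<X>>).
Proof.
case: (boolP (g \in <<X>>)) => [/gen_wordP[s sX <-] | _].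
  exists (size s); rewrite orbF; apply/existsP; exists (in_tuple s).
  by rewrite eqxx andbT; apply/allP.
by exists 0; rewrite orbT.
Qed.

(* Junk value outside <<X>>: the length is then 0. *)
Definition len g := ex_minn (word_size_ex g).

Lemma len_word_le s : {subset s <= X} -> len (\prod_(x <- s) x) <= size s.
Proof.
rewrite /len => sX; case: ex_minnP => k _; apply.
apply/orP; left; apply/existsP; exists (in_tuple s).
by rewrite eqxx andbT; apply/allP.
Qed.

Lemma len_word g : g \in <<X>> ->
  exists s, [/\ {subset s <= X}, \prod_(x <- s) x = g & size s = len g].
Proof.
rewrite /len => Xg; case: ex_minnP => k; rewrite Xg orbF => /existsP[s].
case/andP=> /allP sX /eqP sg _; exists s; split=> //.
exact: size_tuple.
Qed.

Lemma lenM g h :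
  g \in <<X>> -> h \in <<X>> -> len (g * h) <= len g + len h.
Proof.
case/len_word=> s [sX <- <-] /len_word[s' [s'X <- <-]].
rewrite -big_cat -size_cat; apply: len_word_le => x.
by rewrite mem_cat => /orP[/sX | /s'X].
Qed.

Lemma len_gen x : x \in X -> len x <= 1.
Proof.
move=> Xx; rewrite -[x in len x](big_seq1 mulg x id).
by apply: (@len_word_le [:: x]) => y; rewrite inE => /eqP->.
Qed.

Lemma first_letter g : g \in <<X>> -> g != 1 ->
  exists2 x, x \in X & len (x^-1 * g) < len g.
Proof.
move=> /len_word[[|x s] [sX <- <-]]; first by rewrite big_nil eqxx.
move=> _; exists x; first by apply: sX; rewrite inE eqxx.
rewrite big_cons mulKg ltnS; apply: len_word_le => y ys.
by apply: sX; rewrite inE ys orbT.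
Qed.

Lemma lenV g : {in X, forall x, x^-1 = x} -> g \in <<X>> ->
  len g^-1 = len g.
Proof.
move=> XV; suff leV h : h \in <<X>> -> len h^-1 <= len h.
  by move=> Xg; apply/eqP; rewrite eqn_leq leV //= -{1}[g]invgK leV ?groupV.
case/len_word=> s [sX <- <-]; rewrite -(size_rev s).
have -> : (\prod_(x <- s) x)^-1 = \prod_(x <- rev s) x.
  elim: s sX => [|x s IHs] sX; first by rewrite !big_nil invg1.
  rewrite big_cons invMg rev_cons -cats1 big_cat big_seq1 /=.
  rewrite IHs => [|y ys]; last by apply: sX; rewrite inE ys orbT.
  by rewrite XV // sX // inE eqxx.
by apply: len_word_le => x; rewrite mem_rev => /sX.
Qed.

End WordLength.

Lemma len_mono (gT : finGroupType) (X Y : {set gT}) g :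
  Y \subset X -> g \in <<Y>> -> len X g <= len Y g.
Proof.
move=> sYX /len_word[s [sY <- <-]].
by apply: len_word_le => x /sY; apply: subsetP.
Qed.

(** * The inversion cocycle *)

Section InversionCocycle.
Variables (gT : finGroupType) (W : {group gT}) (S : {set gT}).
Hypothesis cox : coxeter_system W S.

(** This is the action of s on roots, a root being coded as a reflection with a sign: s changes the
    sign of its own root only. *)
Definition flip (s : gT) (p : gT * bool) := (p.1 ^ s, p.2 (+) (p.1 == s)).

Fact flip_inj s : injective (flip s).
Proof.
move=> [r b] [r' b'] [/conjg_inj-> /= ].
by move/addIb->.
Qed.

Definition flip_perm s : {perm gT * bool} := perm (@flip_inj s).

(* The reflections crossed by the word (s t)^k are the (s t)^i s for i < 2k. *)
Lemma flip_permM_exp s t k r b : s^-1 = s -> t^-1 = t ->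
  ((flip_perm s * flip_perm t) ^+ k) (r, b) =
    (r ^ ((s * t) ^+ k),
     b (+) \big[addb/false]_(0 <= i < k.*2) (r == (s * t) ^+ i * s)).
Proof.
move=> sV tV; have swap i : s * ((s * t) ^+ i)^-1 = (s * t) ^+ i * s.
  elim: i => [|i IHi]; first by rewrite invg1 mulg1 mul1g.
  by rewrite expgS -[RHS]mulgA -IHi -expgS expgSr invMg invMg sV tV !mulgA.
elim: k => [|k IHk]; first by rewrite !expg0 perm1 conjg1 big_nil addbF.
rewrite expgSr permM IHk permM !permE /flip /= doubleS.
rewrite !big_nat_recr //= -!addbA.
rewrite -!conjgM -expgSr; congr (_, _ (+) (_ (+) (_ (+) _))).
  rewrite (can2_eq (conjgK _) (conjgKV _)) conjgE invgK swap mulgA.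
  by rewrite -expgD addnn.
rewrite (can2_eq (conjgK _) (conjgKV _)) conjgE invgK invMg sV.
rewrite swap mulgA -(mulgA _ s t) -expgSr mulgA.
by rewrite -expgD addSn addnn.
Qed.

(** With m the order of [s * t], the indices i and i + m give the same reflection, so the sign
    changes over i < 2m cancel in pairs. *)
Lemma flip_perm_exp1 s t : s^-1 = s -> t^-1 = t ->
  (flip_perm s * flip_perm t) ^+ #[s * t] = 1.
Proof.
move=> sV tV; apply/permP=> -[r b]; rewrite flip_permM_exp // perm1.
rewrite expg_order conjg1 -addnn (@big_cat_nat _ _ _ #[s * t]) ?leq_addr //=.
rewrite -{2}[#[s * t]]add0n big_addn addnK.
under [X in _ (+) (_ (+) X)]eq_bigr do rewrite expgD expg_order mulg1.
by rewrite addbb addbF.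
Qed.

Lemma coxeter_invg s : s \in S -> s^-1 = s.
Proof.
case: cox => oS _ _ /oS os; apply/eqP.
by rewrite eq_invg_mul -expg2 -os expg_order.
Qed.

Lemma coxeter_gen : <<S>> = W.
Proof. by case: cox. Qed.

Lemma inversion_cocycle_ex : exists nu : gT -> gT -> bool,
  {in W &, forall x y t, nu (x * y) t = nu x t (+) nu y (t ^ x)} /\
  {in S, forall s t, nu s t = (t == s)}.
Proof.
have [oS genS univ] := cox.
have [phi [phiM phiS]] := univ _ flip_perm (fun s t Ss St =>
  flip_perm_exp1 (coxeter_invg Ss) (coxeter_invg St)).
exists (fun w t => (phi w (t, false)).2).
have phi1 : phi 1 = 1.
  by apply: (mulgI (phi 1)); rewrite -phiM ?group1 // !mulg1.
(* The action of w commutes with changing the sign, so its value at [(t, false)] determines the one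
   at [(t, b)]. *)
have phiE w t b : w \in W -> phi w (t, b) = (t ^ w, b (+) (phi w (t, false)).2).
  rewrite -genS => /gen_wordP[s sS <-] {w}.
  elim: s sS t b => [|s1 s IHs] sS t b.
    by rewrite big_nil phi1 !perm1 conjg1 addbF.
  have sS' : {subset s <= S} by move=> x xs; apply: sS; rewrite inE xs orbT.
  have Ss1 : s1 \in S by apply: sS; rewrite inE eqxx.
  have Ws1 : s1 \in W by rewrite -genS mem_gen.
  have Ws : \prod_(x <- s) x \in W by rewrite -genS mem_prod_word.
  rewrite big_cons phiM // !permM (phiS _ Ss1) !permE /flip /=.
  rewrite IHs // [in RHS]IHs //= conjgM.
  by rewrite addbA.
split=> [x y Wx Wy t | s Ss t]; last by rewrite phiS // permE.
by rewrite phiM // permM phiE // phiE.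
Qed.

Lemma sign_ex : exists sg : gT -> bool,
  {in W &, {morph sg : x y / x * y >-> x (+) y}} /\ {in S, forall s, sg s}.
Proof.
have [_ _ univ] := cox.
have [|phi [phiM phiS]] := univ {perm bool} (fun=> tperm true false).
  by move=> s t _ _; rewrite [X in X ^+ _](tperm2 true false) expg1n.
exists (fun w => phi w : bool); split=> [x y Wx Wy | s Ss].
  by rewrite phiM // odd_permM.
by rewrite phiS // odd_tperm.
Qed.

Lemma coxeter_systemJ u : u \in W -> coxeter_system W (S :^ u).
Proof.
have [oS genS univ] := cox => Wu; split=> [s | | H f fS].
- by rewrite mem_conjg => /oS; rewrite orderJ.
- by rewrite genJ genS conjGid.
have [|phi [phiM phiS]] := univ H (fun s => f (s ^ u)).
  by move=> s t Ss St; rewrite -(orderJ _ u) conjMg fS ?memJ_conjg.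
exists (fun w => phi (w ^ u^-1)); split=> [x y Wx Wy | s].
  by rewrite conjMg phiM ?groupJ ?groupV.
by rewrite mem_conjg => /phiS->; rewrite conjgKV.
Qed.

End InversionCocycle.

(** * Reflection subgroups *)

Section Reflections.
Variables (gT : finGroupType) (W : {group gT}) (S : {set gT}).
Hypothesis cox : coxeter_system W S.
Variable nu : gT -> gT -> bool.
Hypothesis nuM :
  {in W &, forall x y t, nu (x * y) t = nu x t (+) nu y (t ^ x)}.
Hypothesis nuS : {in S, forall s t, nu s t = (t == s)}.

Local Notation T := (class_support S W).
Implicit Types (G : {group gT}) (K R X : {set gT}).

Lemma genSW : <<S>> = W. Proof. exact: coxeter_gen cox. Qed.

Lemma SsubW : S \subset W. Proof. by rewrite -genSW subset_gen. Qed.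

Lemma memSW s : s \in S -> s \in W. Proof. exact/subsetP/SsubW. Qed.

Lemma SsubT : S \subset T. Proof. exact: sub_class_support. Qed.

Lemma TsubW : T \subset W. Proof. exact/class_support_subG/SsubW. Qed.

Lemma memTW t : t \in T -> t \in W. Proof. exact/subsetP/TsubW. Qed.

Lemma reflP t : t \in T -> exists s y, [/\ s \in S, y \in W & t = s ^ y].
Proof. by case/imset2P=> s y Ss Wy ->; exists s, y. Qed.

Lemma reflJ t w : w \in W -> (t ^ w \in T) = (t \in T).
Proof.
have JT r x : x \in W -> r \in T -> r ^ x \in T.
  move=> Wx /reflP[s [y [Ss Wy ->]]]; rewrite -conjgM.
  by rewrite memJ_class_support ?groupM.
move=> Ww; apply/idP/idP; last exact: JT.
by move/(JT _ w^-1); rewrite conjgK groupV; apply.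
Qed.

Lemma reflV t : t \in T -> t^-1 = t.
Proof. by case/reflP=> s [y [Ss _ ->]]; rewrite -conjVg (coxeter_invg cox). Qed.

Lemma reflK t g : t \in T -> t * (t * g) = g.
Proof. by move=> Tt; rewrite -{1}(reflV Tt) mulKg. Qed.

Lemma nu1 t : nu 1 t = false.
Proof.
by have := nuM (group1 W) (group1 W) t; rewrite mulg1 conjg1 addbb.
Qed.

Lemma nuV w t : w \in W -> nu w^-1 t = nu w (t ^ w^-1).
Proof.
move=> Ww; have := nuM (groupVr Ww) Ww t.
by rewrite mulVg nu1; case: (nu w^-1 t); case: (nu w _).
Qed.

Lemma nu_sub K g p : K \subset S -> g \in <<K>> -> nu g p -> p \in <<K>>.
Proof.
move=> sKS /gen_wordP[s sK <-] {g}.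
elim: s sK p => [|x s IHs] sK p; first by rewrite big_nil nu1.
have Kx : x \in K by apply: sK; rewrite inE eqxx.
have sK' : {subset s <= K} by move=> y ys; apply: sK; rewrite inE ys orbT.
have Sx := subsetP sKS _ Kx; have Wx := memSW Sx.
have Ws : \prod_(x <- s) x \in W.
  by rewrite -genSW; apply: subsetP (genS sKS) _ (mem_prod_word sK').
rewrite big_cons nuM // nuS //.
case: eqP => [-> _ | _ /= /(IHs sK')]; first exact: mem_gen.
by rewrite groupJr; last exact: mem_gen.
Qed.

Lemma nu_refl w t : w \in W -> nu w t -> t \in T.
Proof.
rewrite -[in w \in _]genSW => /gen_wordP[s sS <-] {w}.
elim: s sS t => [|x s IHs] sS t; first by rewrite big_nil nu1.
have Sx : x \in S by apply: sS; rewrite inE eqxx.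
have sS' : {subset s <= S} by move=> y ys; apply: sS; rewrite inE ys orbT.
have Ws : \prod_(x <- s) x \in W by rewrite -genSW mem_prod_word.
have Wx := memSW Sx; rewrite big_cons nuM // nuS //.
case: eqP => [-> _ | _ /= /(IHs sS')]; first exact: (subsetP SsubT).
by rewrite reflJ.
Qed.

Lemma nu_self t : t \in T -> nu t t.
Proof.
case/reflP=> s [y [Ss Wy ->]]; have Ws := memSW Ss.
rewrite {1}conjgE nuM ?groupV ?groupM // nuM // nuV //.
by rewrite conjgK (nuS Ss) eqxx conjgE mulKg; case: (nu y s).
Qed.

Lemma nu_mul_self t w : t \in T -> w \in W -> nu (t * w) t = ~~ nu w t.
Proof.
by move=> Tt Ww; have Wt := memTW Tt; rewrite nuM // nu_self // conjgE mulKg.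
Qed.

(** * Canonical sets: exchange and descent *)

Definition canonical X :=
  X \subset T /\ {in X & <<X>>, forall x p, nu x p = (p == x)}.

Lemma canonical_subS K : K \subset S -> canonical K.
Proof.
move=> sKS; split=> [|x p Kx _]; first exact: subset_trans sKS SsubT.
by rewrite nuS ?(subsetP sKS).
Qed.

Lemma gen_subW X : X \subset T -> <<X>> \subset W.
Proof. by move=> sXT; rewrite gen_subG (subset_trans sXT) ?TsubW. Qed.

(** Strong exchange for words in X. Read along a word, the cocycle changes only at a letter equal to
    the current conjugate of p, and deleting one such letter gives [p * g]. The conjugates stay in
    [<<X>>], where canonicity determines [nu x]. *)
Lemma canonical_exchange X g p : canonical X -> g \in <<X>> -> p \in <<X>> ->
  nu g p -> len X (p * g) < len X g.
Proof.
case=> sXT canX Xg Xp nugp; have [s [sX gE <-]] := len_word Xg.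
suff [s' [s'X lt_s's <-]]: exists s',
  [/\ {subset s' <= X}, size s' < size s & \prod_(x <- s') x = p * g].
  exact: leq_ltn_trans (len_word_le s'X) lt_s's.
move: nugp; rewrite -gE; elim: s sX {g Xg gE} p Xp => [|x s IHs] sX p Xp.
  by rewrite big_nil nu1.
have Xx : x \in X by apply: sX; rewrite inE eqxx.
have sX' : {subset s <= X} by move=> y ys; apply: sX; rewrite inE ys orbT.
have Ws := subsetP (gen_subW sXT) _ (mem_prod_word sX').
have Tx := subsetP sXT _ Xx; have Wx := memTW Tx.
rewrite big_cons nuM // canX //.
case: eqP => [-> _ | _ /= nusp].
  by exists s; split=> //=; rewrite reflK.
have [|s' [s'X lt_s's s'E]] := IHs sX' (p ^ x) _ nusp.
  by rewrite groupJr; last exact: mem_gen.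
exists (x :: s'); split=> //=.
  by move=> y; rewrite inE => /predU1P[-> // | /s'X].
by rewrite big_cons s'E conjgE !mulgA mulgV mul1g.
Qed.

Lemma exists_descent X g : X \subset T ->
  {in <<X>> & X, forall h x, nu h x -> len X (x * h) < len X h} ->
  g \in <<X>> -> g != 1 -> exists2 x, x \in X & nu g x.
Proof.
move=> sXT descX Xg g1; have [x Xx] := first_letter Xg g1.
have Tx := subsetP sXT _ Xx; have Wg := subsetP (gen_subW sXT) _ Xg.
rewrite reflV // => lt_xg; exists x => //; apply: contraLR lt_xg => nug.
have Xxg : x * g \in <<X>> by rewrite groupM // mem_gen.
rewrite -leqNgt ltnW // -{1}[g](reflK _ Tx) descX //.
by rewrite nu_mul_self.
Qed.

Lemma canonical_descent X g : canonical X ->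
  g \in <<X>> -> g != 1 -> exists2 x, x \in X & nu g x.
Proof.
move=> canX; have [sXT _] := canX; apply: exists_descent => // h x Xh Xx.
by apply: canonical_exchange => //; apply: mem_gen.
Qed.

Lemma lenS_lt w q : w \in W -> nu w q -> len S (q * w) < len S w.
Proof.
move=> Ww nuw; apply: canonical_exchange; rewrite ?genSW //.
  exact: canonical_subS.
exact/memTW/(nu_refl Ww).
Qed.

Lemma lenS_gt w q : w \in W -> q \in T -> ~~ nu w q ->
  len S w < len S (q * w).
Proof.
move=> Ww Tq nuw; rewrite -{1}[w](reflK _ Tq) lenS_lt ?nu_mul_self //.
by rewrite groupM ?(memTW Tq).
Qed.

(** Let [g * v] be shortest in the coset of v. It inverts no reflection of [<<X>>], so v and [g^-1]
    invert the same ones there. If g were not 1, [g^-1] would invert some x in X. *)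
Lemma canonical_nu0 X v q : canonical X -> v \in W ->
  {in X, forall x, ~~ nu v x} -> q \in <<X>> -> ~~ nu v q.
Proof.
move=> canX Wv nuv; have [sXT _] := canX; have sXW := subsetP (gen_subW sXT).
case: (@arg_minnP _ 1 [in <<X>>] (fun g => len S (g * v))) => // g Xg min_g.
have Wg := sXW _ Xg.
have nugv p : p \in <<X>> -> ~~ nu (g * v) p.
  move=> Xp; apply/negP=> /(lenS_lt (groupM Wg Wv)).
  by rewrite mulgA ltnNge min_g //; apply: groupM.
have nuvE p : p \in <<X>> -> nu v p = nu g^-1 p.
  move=> Xp; have := nugv (p ^ g^-1).
  rewrite groupJ ?groupV // nuM // conjgKV nuV //.
  by move/(_ isT); case: (nu v p); case: nu.
have [g1 | /eqP g1] := eqVneq g^-1 1.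
  by move=> Xq; rewrite nuvE // g1 nu1.
have [x Xx] := canonical_descent canX (groupVr Xg) (introN eqP g1).
by rewrite -(nuvE x (mem_gen Xx)) (negPf (nuv x Xx)).
Qed.

(** * Longest elements of standard parabolic subgroups *)

Lemma exists_longest X : X \subset S ->
  exists2 h, h \in <<X>> & {in T, forall p, p \in <<X>> -> nu h p}.
Proof.
move=> sXS; have sXW := subsetP (gen_subW (subset_trans sXS SsubT)).
case: (@arg_maxnP _ 1 [in <<X>>] (len S)) => // h Xh max_h.
exists h => // p Tp Xp; apply: contraT => /(lenS_gt (sXW _ Xh) Tp).
by rewrite ltnNge => /negP[]; apply: max_h; apply: groupM.
Qed.

(** In the cocycle expansion of [nu (x ^ h)] the two contributions of h cancel, so [x ^ h] inverts
    only itself; its descent in X is therefore [x ^ h]. *)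
Lemma longestJ X h x : X \subset S -> h \in <<X>> ->
  {in T, forall p, p \in <<X>> -> nu h p} -> x \in X -> x ^ h \in X.
Proof.
move=> sXS Xh nuh Xx; have canX := canonical_subS sXS; have [sXT _] := canX.
have sXW := subsetP (gen_subW sXT); have Sx := subsetP sXS _ Xx.
have XXx : x \in <<X>> by apply: mem_gen.
have Txh : x ^ h \in T by rewrite reflJ ?sXW ?(subsetP sXT).
have x1 : x ^ h != 1.
  by apply: contraTneq (nu_self Txh) => ->; rewrite nu1.
have [y Xy] := canonical_descent canX (groupJ XXx Xh) x1.
suff -> : nu (x ^ h) y = (y == x ^ h) by move=> /eqP <-.
have XXy : y \in <<X>> by apply: mem_gen.
have Ty := subsetP sXT _ Xy.
rewrite conjgE nuM ?groupM ?groupV ?sXW // nuM ?sXW // nuV ?sXW //.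
rewrite !nuh ?groupJ ?groupV // ?reflJ ?groupV ?sXW //.
by rewrite nuS // (can2_eq (conjgKV _) (conjgK _)) addbT /= negbK.
Qed.

(** * Dyer's canonical generators of a reflection subgroup *)

Definition chi G := [set q in G | [forall p in G, nu q p == (p == q)]].

Lemma chiP G q :
  reflect (q \in G /\ {in G, forall p, nu q p = (p == q)}) (q \in chi G).
Proof.
rewrite inE; apply: (iffP andP) => [[Gq /forall_inP nuq] | [Gq nuq]].
  by split=> // p /nuq/eqP.
by split=> //; apply/forall_inP=> p /nuq->.
Qed.

Lemma chi_sub G : chi G \subset G.
Proof. by apply/subsetP=> q /chiP[]. Qed.

Lemma chi_subT G : G \subset W -> chi G \subset T.
Proof.
move=> sGW; apply/subsetP=> q /chiP[Gq nuq].
by apply: (@nu_refl q); rewrite ?nuq ?eqxx ?(subsetP sGW).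
Qed.

Lemma canonical_sub_chi G X : G \subset W -> X \subset chi G -> canonical X.
Proof.
move=> sGW sXG; split=> [|x p /(subsetP sXG)/chiP[_ nux] Xp].
  exact: subset_trans sXG (chi_subT sGW).
by apply: nux; apply: subsetP Xp; rewrite gen_subG (subset_trans sXG) ?chi_sub.
Qed.

Lemma canonical_chi G : G \subset W -> canonical (chi G).
Proof. by move/canonical_sub_chi; apply. Qed.

(** Conjugation by s disturbs the cocycle only where s itself occurs, and s occurs neither in G nor
    in [G :^ s]. *)
Lemma chiJ G s q : G \subset W -> s \in S -> s \notin G ->
  q \in chi G -> q ^ s \in chi (G :^ s).
Proof.
move=> sGW Ss Gs /chiP[Gq nuq]; have sV := coxeter_invg cox Ss.
have Ws := memSW Ss; have Wq := subsetP sGW _ Gq.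
apply/chiP; rewrite memJ_conjg; split=> // _ /imsetP[p Gp ->].
rewrite {1}conjgE sV nuM ?groupM // nuM // !(nuS Ss).
have -> : (p ^ s) ^ s = p by rewrite -{2}sV conjgK.
rewrite nuq // (can_eq (conjgK s)).
have neq_s r : r \in G -> (r == s) = false.
  by move=> Gr; apply: contraNF Gs => /eqP <-.
have -> : (p ^ s == s) = (p == s).
  rewrite (can2_eq (conjgK s) (conjgKV s)) conjgE invgK sV.
  by rewrite mulgA -{1}sV mulVg mul1g.
by rewrite !neq_s ?groupJ // addbF.
Qed.

(* Peel the conjugating word of t one letter x at a time, and pass from G to  *)
(* its conjugate by x whenever x lies outside G.                              *)
Lemma refl_chi_gen G t : G \subset W -> t \in T -> t \in G -> t \in <<chi G>>.
Proof.
move=> sGW /reflP[s [y [Ss Wy ->]]].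
move: Wy; rewrite -genSW => /gen_wordP[w wS <-] {y t}.
elim/last_ind: w wS G sGW => [|w x IHw] wS G sGW.
  rewrite big_nil conjg1 => Gs; apply/mem_gen/chiP; split=> // p _.
  exact: nuS.
have Sx : x \in S by apply: wS; rewrite mem_rcons inE eqxx.
have wS' : {subset w <= S}.
  by move=> z zw; apply: wS; rewrite mem_rcons inE zw orbT.
have xV := coxeter_invg cox Sx.
rewrite -cats1 big_cat big_seq1 /= conjgM => Gt.
have [Gx | Gx] := boolP (x \in G).
  have chix : x \in chi G by apply/chiP; split=> // p _; apply: nuS.
  by rewrite groupJr ?(mem_gen chix) // IHw // -(groupJr _ Gx).
have sGxW : G :^ x \subset W by rewrite -(conjGid (memSW Sx)) conjSg.
have : s ^ (\prod_(z <- w) z) \in <<chi (G :^ x)%G>>.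
  by apply: IHw => //; rewrite mem_conjg xV.
rewrite -(memJ_conjg _ x) -genJ; apply: subsetP; apply: genS.
apply/subsetP=> _ /imsetP[q chiq ->].
suff: q ^ x \in chi ((G :^ x) :^ x)%G.
  congr (_ \in chi _); apply: val_inj; rewrite /= -conjsgM -{1}xV mulVg.
  exact: conjsg1.
apply: chiJ => //; rewrite mem_conjg xV.
by apply: contra Gx; rewrite conjgE mulKg.
Qed.

Lemma gen_chi G R : R \subset T -> <<R>> = G -> <<chi G>> = G.
Proof.
move=> sRT genR; apply/eqP; rewrite eqEsubset gen_subG chi_sub /=.
rewrite -{1}genR gen_subG.
apply/subsetP=> t Rt; apply: refl_chi_gen; last by rewrite -genR mem_gen.
  by rewrite -genR gen_subW.
exact: subsetP Rt.
Qed.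

Lemma refl_neq1 t : t \in T -> t != 1.
Proof. by move=> Tt; apply: contraTneq (nu_self Tt) => ->; rewrite nu1. Qed.

Lemma refl_cycle t : t \in T -> <[t]> = [set 1; t].
Proof.
move=> Tt; apply: cycle2g; apply: nt_prime_order (refl_neq1 Tt) => //.
by rewrite expg2 -[t * t]mulg1 -mulgA reflK.
Qed.

Lemma sign_refl (sg : gT -> bool) :
  {in W &, {morph sg : x y / x * y >-> x (+) y}} -> {in S, forall s, sg s} ->
  {in T, forall t, sg t}.
Proof.
move=> sgM sgS _ /reflP[s [y [Ss Wy ->]]].
have Ws := memSW Ss; have sg1 : sg 1 = false.
  by have := sgM _ _ (group1 W) (group1 W); rewrite mulg1 addbb.
have := sgM _ _ (groupVr Wy) Wy; rewrite mulVg sg1 conjgE.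
rewrite !sgM ?groupM ?groupV // (sgS _ Ss).
by case: (sg y); case: (sg y^-1).
Qed.

(** * Subgroups generated by two reflections *)

Section RankTwo.
Variables (G : {group gT}) (r r' : gT).
Hypotheses (Tr : r \in T) (Tr' : r' \in T) (defG : <<[set r; r']>> = G).

Let C := <[r * r']>.

Fact rank2_subW : G \subset W.
Proof.
rewrite -defG gen_subG; apply/subsetP=> x /set2P[]->; exact: memTW.
Qed.

Fact rank2_rotJ : (r * r') ^ r = (r * r')^-1.
Proof. by rewrite conjgE invMg !reflV // -mulgA reflK. Qed.

Fact rank2_norm : r \in 'N(C).
Proof.
by rewrite inE -cycleJ rank2_rotJ cycleV.
Qed.

(* The sign character keeps reflections out of the rotation subgroup. *)
Fact rank2_refl t : t \in T -> t \in G -> exists2 v, v \in C & t = v * r.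
Proof.
move=> Tt Gt; have [sg [sgM sgS]] := sign_ex cox.
have sgT := sign_refl sgM sgS.
have sgC v : v \in C -> sg v = false.
  case/cycleP=> i ->; have Wrr : r * r' \in W by rewrite groupM ?memTW.
  elim: i => [|i IHi]; last first.
    by rewrite expgS sgM ?groupX // IHi sgM ?memTW // !sgT.
  by have := sgM _ _ (group1 W) (group1 W); rewrite mulg1 addbb.
have : t \in C * <[r]>.
  rewrite -norm_joinEr ?cycle_subG ?rank2_norm //.
  apply: subsetP Gt; rewrite -defG gen_subG.
  have Jr : r \in C <*> <[r]> by rewrite mem_gen // inE cycle_id orbT.
  have Jrr' : r * r' \in C <*> <[r]> by rewrite mem_gen // inE cycle_id.
  by apply/subsetP=> x /set2P[]-> //; rewrite -(groupMl _ Jr).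
case/mulsgP=> v x Cv; rewrite refl_cycle // => /set2P[]->; last by exists v.
by rewrite mulg1 => tv; have := sgC v Cv; rewrite -tv sgT.
Qed.

Fact rank2_mul t t' : t \in T -> t' \in T -> t \in G -> t' \in G ->
  t * t' \in C.
Proof.
move=> Tt Tt' Gt Gt'; have [v Cv ->] := rank2_refl Tt Gt.
have [v' Cv' ->] := rank2_refl Tt' Gt'.
have -> : v * r * (v' * r) = v * v' ^ r by rewrite conjgE reflV // -mulgA.
by rewrite groupM // memJ_norm ?rank2_norm.
Qed.

Fact rank2_invert t v : t \in T -> t \in G -> v \in C -> v ^ t = v^-1.
Proof.
move=> Tt Gt Cv; have [v' Cv' ->] := rank2_refl Tt Gt.
have cvv' : v ^ v' = v.
  by apply/conjg_fixP/commgP; exact: (centsP (cycle_abelian (r * r'))).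
rewrite conjgM cvv'; case/cycleP: Cv => i ->.
by rewrite conjXg rank2_rotJ expgVn.
Qed.

Let chiE x p : x \in chi G -> p \in G -> nu x p = (p == x).
Proof. by case/chiP=> _; apply. Qed.

Let chiG x : x \in chi G -> x \in G. Proof. by case/chiP. Qed.

Let chiT x : x \in chi G -> x \in T.
Proof. exact: (subsetP (chi_subT rank2_subW)). Qed.

(** If [y ^ x] were z, which does not invert x, the cocycle at x would force x and y to commute,
    hence z = y. *)
Fact rank2_chi_neqJ x y z : x \in chi G -> y \in chi G -> z \in chi G ->
  x != y -> y != z -> x != z -> y ^ x != z.
Proof.
move=> chix chiy chiz xy yz xz; apply: contraNneq yz => zE.
have [Tx Ty] := (chiT chix, chiT chiy); have [Wx Wy] := (memTW Tx, memTW Ty).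
have [Gx Gy] := (chiG chix, chiG chiy).
have := chiE chiz Gx; rewrite (negPf xz) -zE {1}conjgE reflV //.
rewrite nuM ?groupM // nuM // chiE // eqxx conjgE mulKg chiE // (negPf xy).
rewrite chiE ?groupJ //= => /negbFE/eqP/conjg_fixP/commgP cxy.
by rewrite eq_sym; apply/eqP/conjg_fixP/commgP/commute_sym.
Qed.

(** The reflection c inverts the rotation [b * a], so [b * a * c = c * a * b]. Comparing [nu] of
    both sides at c shows that c also commutes with [b * a], which is thus its own inverse. *)
Fact rank2_chi_mul_order2 a b c : a \in chi G -> b \in chi G -> c \in chi G ->
  a != b -> b != c -> a != c -> #[b * a] = 2.
Proof.
move=> chia chib chic ab bc ac.
have [[Ta Tb] Tc] := (chiT chia, chiT chib, chiT chic).
have [[Wa Wb] Wc] := (memTW Ta, memTW Tb, memTW Tc).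
have [[Ga Gb] Gc] := (chiG chia, chiG chib, chiG chic).
have Cba : b * a \in C by rewrite rank2_mul.
have baV : (b * a)^-1 = a * b by rewrite invMg !reflV.
have bacE : b * (a * c) = c * (a * b).
  by rewrite mulgA -baV -(rank2_invert Tc Gc Cba) conjgE mulgA mulgV mul1g.
have cb : (c ^ b == a) = false.
  rewrite (can2_eq (conjgK b) (conjgKV b)) reflV // eq_sym.
  by apply/negbTE/rank2_chi_neqJ; rewrite // eq_sym.
have ca : (c ^ a == b) = false.
  rewrite (can2_eq (conjgK a) (conjgKV a)) reflV // eq_sym.
  exact/negbTE/rank2_chi_neqJ.
have cba : (c ^ b) ^ a == c.
  have := congr1 (nu^~ c) bacE; rewrite !nuM ?groupM // !chiE ?groupJ //.
  rewrite eqxx [c ^ c]conjgE mulKg !(eq_sym c) (negPf bc) (negPf ac).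
  by rewrite cb ca.
apply: nt_prime_order => //; last by rewrite -eq_invg_mul reflV // eq_sym.
have /commute_sym/commgP/conjg_fixP : commute c (b * a).
  by apply/commgP/conjg_fixP; rewrite conjgM; apply/eqP.
rewrite rank2_invert // => baVE.
by apply/eqP; rewrite expg2 -eq_invg_mul baVE.
Qed.

(** Three elements a, b, c would give two distinct involutions [b * a] and [c * a] in the cyclic
    group [C]. *)
Lemma card_chi_rank2 : #|chi G| <= 2.
Proof.
rewrite leqNgt; apply/card_gt2P=> -[a [b [c [[chia chib chic] [ab bc ca]]]]].
have Cmul x y : x \in chi G -> y \in chi G -> x * y \in C.
  by move=> chix chiy; rewrite rank2_mul ?chiG ?chiT.
have oba : #[b * a] = 2 by rewrite (@rank2_chi_mul_order2 a b c) // eq_sym.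
have oca : #[c * a] = 2 by rewrite (@rank2_chi_mul_order2 a c b) // eq_sym.
have : <[c * a]> == <[b * a]>.
  rewrite (eq_subG_cyclic (cycle_cyclic (r * r'))) ?cycle_subG ?Cmul //.
  by rewrite -![#|_|]/(#[_]) oba oca.
move/eqP=> eq_cyc; have : c * a \in <[b * a]> by rewrite -eq_cyc cycle_id.
rewrite (cycle2g oba) !inE (can_eq (mulgK a)) (eq_sym c) (negPf bc) orbF.
by rewrite -eq_invg_mul reflV ?chiT // (negPf ca).
Qed.

End RankTwo.

(** * Parabolic subgroups containing given reflections *)

(** Right multiplication by the longest element complements the set of inverted reflections; here
    the complement contains no simple reflection, so it is empty. *)
Lemma all_descents_longest w p : w \in W -> {in S, forall s, nu w s} ->
  p \in T -> nu w p.
Proof.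
move=> Ww nuw Tp; have [h Sh nuh] := exists_longest (subxx S).
have Wh : h \in W by rewrite -genSW.
have nuwh s : s \in S -> ~~ nu (w * h) s.
  move=> Ss; have Ws := memSW Ss.
  by rewrite nuM // nuw // nuh ?genSW ?groupJ ?reflJ ?(subsetP SsubT).
have := canonical_nu0 (canonical_subS (subxx S)) (groupM Ww Wh) nuwh.
have Wp := memTW Tp; move=> /(_ p); rewrite genSW nuM //.
rewrite [nu h _]nuh ?genSW ?groupJ ?reflJ //.
by rewrite addbT negbK => /(_ Wp).
Qed.

(* Walk through the chambers u having J among their walls, starting from one  *)
(* at which t is not inverted and always crossing a residue of rank #|J| + 1  *)
(* to its far side: t lies in the stabilizer of the residue in which it       *)
(* becomes inverted.                                                          *)
Lemma parabolic_step (J : {set gT}) t : J \subset S -> t \in T ->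
  exists u K, [/\ u \in W, K \subset S :^ u, #|K| <= #|J|.+1,
                  J \subset K & t \in <<K>>].
Proof.
move=> sJS Tt; have [Jt | Jt] := boolP (t \in <<J>>).
  by exists 1, J; rewrite group1 conjsg1 leqnSn.
have sJW := subsetP (gen_subW (subset_trans sJS SsubT)).
have [p Jp nup] := exists_longest sJS; have Wp := sJW _ Jp.
have pJ j : j \in J -> j ^ p \in J by apply: longestJ.
(* [A] holds at the chambers of the walk having J among their walls, lying beyond all reflections of
   [<<J>>] but not beyond t; one with most inversions is chosen. *)
pose A u := [&& u \in W, J :^ u \subset S,
  [forall q in <<J>>, (q \in T) ==> nu u q] & ~~ nu u t].
have Ap : A p.
  apply/and4P; split=> //.
  - by apply/subsetP=> _ /imsetP[j Jj ->]; rewrite (subsetP sJS) ?pJ.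
  - by apply/forall_inP=> q Jq; apply/implyP=> Tq; apply: nup.
  - by apply: contra Jt; apply: nu_sub.
case: (arg_maxnP (fun u => #|[set q | nu u q]|) Ap) => u /and4P[Wu JuS nuJ nut].
move=> max_u; have {}nuJ q : q \in T -> q \in <<J>> -> nu u q.
  by move=> Tq Jq; have /implyP := forall_inP nuJ q Jq; apply.
have [s Ss nus] : exists2 s, s \in S & ~~ nu u^-1 s.
  apply/exists_inP; apply: contraNT nut.
  rewrite negb_exists_in => /forall_inP nuS1.
  have -> : nu u t = nu u^-1 (t ^ u) by rewrite nuV // conjgK.
  apply: all_descents_longest; rewrite ?groupV ?reflJ // => s Ss.
  by apply: negbNE; apply: nuS1.
pose X := s |: (J :^ u).
have sXS : X \subset S by rewrite subUset sub1set Ss.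
have sXW := subsetP (gen_subW (subset_trans sXS SsubT)).
have JX q : (q \in <<J>>) -> q ^ u \in <<X>>.
  rewrite -(memJ_conjg _ u) -genJ; apply: subsetP; apply: genS.
  exact: subsetUr.
have [h Xh nuh] := exists_longest sXS.
(* Since [u * k = p * u * h], this first goes to the chamber [p * u] of the residue nearest to 1,
   then across the residue by its longest element. *)
pose k := p ^ u * h; have Xk : k \in <<X>> by rewrite groupM ?JX.
have [Wh Wk] := (sXW _ Xh, sXW _ Xk).
have Wpu : p * u \in W by rewrite groupM.
have nuk q : q \in T -> q ^ u \in <<X>> -> nu (u * k) q.
  move=> Tq Xq; have Xqpu : q ^ (p * u) \in <<X>>.
    by rewrite conjgC conjgM groupJ ?(JX _ Jp).
  have -> : u * k = p * u * h by rewrite /k mulgA -conjgC.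
  rewrite nuM // [nu h _]nuh ?reflJ // addbT.
  have -> : nu (p * u) q = nu (p * u)^-1 (q ^ (p * u)) by rewrite nuV // conjgK.
  apply: canonical_nu0 (canonical_subS sXS) _ _ Xqpu; first by rewrite groupV.
  move=> x Xx; have Tx : x \in T by rewrite (subsetP SsubT) ?(subsetP sXS).
  rewrite invMg nuM ?groupV //; case/setU1P: Xx => [-> | Jx].
    rewrite (negPf nus) /=; apply: contra nus => /nu_sub nu_sub_p.
    rewrite nuV // nuJ ?reflJ ?groupV ?(subsetP SsubT) //.
    by apply: nu_sub_p; rewrite ?groupV.
  have {}Jx : x ^ u^-1 \in J by rewrite -mem_conjg.
  have Txu : x ^ u^-1 \in T by rewrite reflJ ?groupV.
  rewrite nuV // nuJ // ?mem_gen // nuV // nup //.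
    by rewrite reflJ ?groupV.
  by rewrite groupJr ?groupV // mem_gen.
have [Xt | Xt] := boolP (t ^ u \in <<X>>).
  exists u^-1, (X :^ u^-1); rewrite groupV conjSg cardJg cardsU1 cardJg.
  split=> //; first by rewrite -add1n leq_add2r leq_b1.
    by rewrite -sub_conjg subsetUr.
  by rewrite genJ mem_conjgV.
have nukE q : q ^ u \notin <<X>> -> nu (u * k) q = nu u q.
  move=> Xq; rewrite nuM // (_ : nu k _ = false) ?addbF //.
  by apply: contraNF Xq; apply: nu_sub.
(* If t does not stabilize the residue, the walk continues: [u * k] inverts all that u does and
   [s ^ u^-1] too, against maximality. *)
suff /max_u : A (u * k).
  rewrite /= leqNgt => /negP[]; apply: proper_card; apply/properP; split.
    apply/subsetP=> q; rewrite !inE => nuq.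
    have [Xq | /nukE-> //] := boolP (q ^ u \in <<X>>).
    exact/nuk/Xq/(nu_refl Wu).
  exists (s ^ u^-1); rewrite !inE -?nuV //; apply: nuk.
    by rewrite reflJ ?groupV ?(subsetP SsubT).
  by rewrite conjgKV mem_gen // setU11.
apply/and4P; split; first by rewrite groupM.
- apply/subsetP=> _ /imsetP[j Jj ->]; rewrite /k mulgA -conjgC -mulgA !conjgM.
  apply/(subsetP sXS)/longestJ => //.
  by rewrite inE memJ_conjg pJ ?orbT.
- by apply/forall_inP=> q Jq; apply/implyP=> Tq; apply: nuk => //; apply: JX.
- by rewrite nukE.
Qed.

(** * Pairwise canonical generating sets *)

Section PairwiseCanonical.
Variable X : {set gT}.
Hypotheses (sXT : X \subset T) (genX : <<X>> = W).
Hypothesis canX : {in X &, forall x y, x != y -> canonical [set x; y]}.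

(* Factor w = d v with d in the dihedral group of x and the first letter y of *)
(* w, and v as short as possible: v inverts no reflection of that group.      *)
Fact pairwise_canonical_descent w x : w \in <<X>> -> x \in X ->
  nu w x -> len X (x * w) < len X w.
Proof.
have [n] := ubnP (len X w); elim: n => // n IHn in w x *; rewrite ltnS => le_wn.
move=> Xw Xx nuw; have Ww : w \in W by rewrite -genX.
have w1 : w != 1 by apply: contraTneq nuw => ->; rewrite nu1.
have [y Xy] := first_letter Xw w1.
have [Tx Ty] := (subsetP sXT _ Xx, subsetP sXT _ Xy).
rewrite reflV // => lt_yw; have [-> // | xy] := eqVneq x y.
have canY := canX Xx Xy xy; set Y := [set x; y] in canY.
have sYX : Y \subset X by apply/subsetP=> z /set2P[]->.
have XY := subsetP (genS sYX).
(* The bound in [P] makes any shortening of d one of w. The witness [y * w] corresponds to d = y and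
   forces the minimal v to be shorter than w, so the induction applies to v. *)
pose P v := (w * v^-1 \in <<Y>>) && (len Y (w * v^-1) + len X v <= len X w).
have Py : P (y * w).
  have Yy : y \in Y by rewrite set22.
  rewrite /P invMg mulKVg reflV // mem_gen //=.
  by apply: leq_trans (leq_add (len_gen Yy) (leqnn _)) _; rewrite add1n.
case: (arg_minnP (len X) Py) => v /andP[]; set d := w * v^-1 => Yd le_dv min_v.
have wE : w = d * v by rewrite mulgKV.
have Xd := XY _ Yd; have Xv : v \in <<X>> by rewrite -(groupMl _ Xd) -wE.
have [Wd Wv] : d \in W /\ v \in W by rewrite -genX.
have nuv z : z \in Y -> ~~ nu v z.
  move=> Yz; have Xz := subsetP sYX _ Yz; apply/negP=> nuvz.
  have lt_zv : len X (z * v) < len X v.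
    apply: IHn => //; apply: leq_trans le_wn.
    by apply: leq_ltn_trans (min_v _ Py) lt_yw.
  have := lt_zv; rewrite ltnNge => /negP[]; apply: min_v.
  have YYz := mem_gen Yz.
  rewrite /P invMg mulgA -/d reflV ?(subsetP sXT) // groupM //=.
  apply: leq_trans _ le_dv.
  apply: leq_trans (leq_add (lenM Yd YYz) (leqnn _)) _.
  rewrite -addnA leq_add2l; apply: leq_trans lt_zv.
  by rewrite -add1n leq_add2r len_gen.
move: nuw; rewrite wE nuM // (negPf (canonical_nu0 canY Wv nuv _)) ?addbF.
  move=> nud; have Yx : x \in <<Y>> by rewrite mem_gen ?set21.
  have lt_xd := canonical_exchange canY Yd Yx nud.
  rewrite -wE; apply: leq_trans _ le_dv; rewrite [in x * w]wE mulgA.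
  apply: leq_ltn_trans (lenM _ Xv) _; first exact: groupM (XY _ Yx) Xd.
  by rewrite ltn_add2r (leq_ltn_trans (len_mono sYX (groupM Yx Yd)) lt_xd).
by rewrite groupJ // mem_gen ?set21.
Qed.

(** An s in S inverts only itself, so its descent in X is s. Conversely x in X inverts some s in S,
    now a member of X, and canonicity of the pair gives x = s. *)
Lemma pairwise_canonical_simple : X = S.
Proof.
have sSX : S \subset X.
  apply/subsetP=> s Ss; have Ts := subsetP SsubT _ Ss.
  have [|x Xx] :=
    exists_descent sXT pairwise_canonical_descent _ (refl_neq1 Ts).
    by rewrite genX memSW.
  by rewrite nuS // => /eqP <-.
apply/eqP; rewrite eqEsubset sSX andbT; apply/subsetP=> x Xx.
have Tx := subsetP sXT _ Xx.
have [|s Ss nuxs] :=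
  canonical_descent (canonical_subS (subxx S)) _ (refl_neq1 Tx).
  by rewrite genSW memTW.
have [-> // | xs] := eqVneq x s.
have [_ canxs] := canX Xx (subsetP sSX _ Ss) xs.
by move: nuxs; rewrite canxs ?set21 ?mem_gen ?set22 // eq_sym (negPf xs).
Qed.

End PairwiseCanonical.

(** * Canonical generators inside a proper parabolic subgroup *)

Lemma mem_gen_simple K s : K \subset S -> s \in S -> s \in <<K>> -> s \in K.
Proof.
move=> sKS Ss Ks; have s1 := refl_neq1 (subsetP SsubT _ Ss).
have [k Kk] := canonical_descent (canonical_subS sKS) Ks s1.
by rewrite nuS // => /eqP <-.
Qed.

(** Everything inverted by an element of [<<K>>] lies in [<<K>>], so the descents of g in X can be
    stripped without leaving [<<K>>]. *)
Lemma canonical_inter X K g : canonical X -> K \subset S ->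
  g \in <<X>> -> g \in <<K>> -> g \in <<X :&: <<K>> >>.
Proof.
move=> canX sKS; have [sXT _] := canX.
have [n] := ubnP (len X g); elim: n => // n IHn in g *; rewrite ltnS => le_gn.
move=> Xg Kg; have [-> | g1] := eqVneq g 1; first exact: group1.
have [x Xx nugx] := canonical_descent canX Xg g1.
have [Kx XXx] := (nu_sub sKS Kg nugx, mem_gen Xx).
have Tx := subsetP sXT _ Xx.
rewrite -(reflK g Tx) groupM //; first by rewrite mem_gen // inE Xx.
apply: IHn; rewrite ?groupM //.
exact: leq_trans (canonical_exchange canX Xg XXx nugx) le_gn.
Qed.

(** Stripping descents lowers the S-length until b or [b * a] is reached. The latter is as long as
    its inverse [a * b], which inverts a and so is longer than b. *)
Lemma canonical_pair_len a b g : canonical [set a; b] -> a != b ->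
  g \in <<[set a; b]>> -> g != 1 -> g != a -> g != b -> len S b < len S g.
Proof.
move=> can_ab ab; have [sabT _] := can_ab; have sabW := subsetP (gen_subW sabT).
have [Ta Tb] : a \in T /\ b \in T by rewrite !(subsetP sabT) ?set21 ?set22.
have [Wa Wb] := (memTW Ta, memTW Tb).
have SV : {in S, forall x, x^-1 = x} by move=> x Sx; apply: (coxeter_invg cox).
have [n] := ubnP (len S g); elim: n => // n IHn in g *; rewrite ltnS => le_gn.
move=> abg g1 ga gb; have Wg := sabW _ abg.
have [x abx nugx] := canonical_descent can_ab abg g1.
have Tx := subsetP sabT _ abx; have lt_xg := lenS_lt Wg nugx.
have gE := reflK g Tx.
have [xg1 | xg1] := eqVneq (x * g) 1.
  by move: abx ga gb; rewrite -gE xg1 mulg1 !inE => /orP[]/eqP->; rewrite eqxx.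
have [xga | xga] := eqVneq (x * g) a.
  move: abx g1; rewrite -gE xga => /set2P[]->.
    by rewrite -[a * a]mulg1 -mulgA reflK ?eqxx.
  move=> _; rewrite -[len S (b * a)](lenV SV) ?genSW ?groupM // invMg !reflV //.
  have [_ can_b] := can_ab.
  have nuab : nu (a * b) a.
    by rewrite nu_mul_self // can_b ?set22 ?mem_gen ?set21.
  by have := lenS_lt (groupM Wa Wb) nuab; rewrite reflK.
have [xgb | xgb] := eqVneq (x * g) b; first by rewrite -xgb.
apply: (ltn_trans _ lt_xg); apply: IHn => //; last by rewrite groupM // mem_gen.
exact: leq_trans lt_xg le_gn.
Qed.

Lemma chi_simple G R K t : R \subset T -> <<R>> = G -> t \in T ->
  K \proper S -> G \subset <<K>> -> <<t |: G>> = W -> chi G \subset S.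
Proof.
move=> sRT genR Tt /properP[sKS [s0 Ss0 Ks0]] sGK gen_t.
have sGW : G \subset W by rewrite -genR gen_subW.
pose P t := (t \in T) && (<<t |: G>> == W).
have Pt : P t by rewrite /P Tt gen_t eqxx.
case: (arg_minnP (len S) Pt) => {Pt gen_t}{}t /andP[{}Tt /eqP gen_t] min_t.
have Kt : t \notin <<K>>.
  apply: contra Ks0 => Kt; apply: mem_gen_simple => //.
  apply: subsetP (memSW Ss0); rewrite -gen_t gen_subG subUset sub1set Kt.
  exact: sGK.
have can_t g : g \in chi G ->
    g \in chi <<[set g; t]>>%G /\ t \in chi <<[set g; t]>>%G.
  move=> chig; set D := <<_>>%G; have [Gg _] := chiP _ _ chig.
  have Tg := subsetP (chi_subT sGW) _ chig.
  have sgtT : [set g; t] \subset T by apply/subsetP=> x /set2P[]->.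
  have sDW : D \subset W by apply: gen_subW.
  have genD : <<chi D>> = D by apply: gen_chi sgtT _.
  have canD := canonical_chi sDW.
  have [Dg Dt] : g \in D /\ t \in D by rewrite !mem_gen ?set21 ?set22.
  have Kg : g \in <<K>> by apply: subsetP Gg.
  have [b chib Kb] : exists2 b, b \in chi D & b \notin <<K>>.
    apply/subsetPn; apply: contra Kt => sDK; apply: subsetP Dt.
    by rewrite -genD gen_subG.
  (* As b is outside [<<K>>], at most one element of [chi D] is inside; it generates a group
     containing g, so it equals g. *)
  have gK : g \in <<chi D :&: <<K>> >> by apply: canonical_inter; rewrite ?genD.
  have chi_le2 : #|chi D| <= 2 by apply: card_chi_rank2 Tg Tt _.
  have lt_K : #|chi D :&: <<K>>| < 2.
    apply: leq_trans chi_le2; apply/proper_card/properP.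
    split; first exact: subsetIl.
    by exists b; rewrite // inE (negPf Kb) andbF.
  have Dchig : g \in chi D.
    have [K0 | [a Aa]] := set_0Vmem (chi D :&: <<K>>).
      by move: gK (refl_neq1 Tg); rewrite K0 gen0 => /set1P->; rewrite eqxx.
    have AE : chi D :&: <<K>> = [set a].
      by apply/eqP; rewrite eq_sym eqEcard sub1set Aa cards1.
    have [chia _] := setIP Aa; move: gK; rewrite AE.
    rewrite -[<<_>>]/<[a]> refl_cycle ?(subsetP (chi_subT sDW)) //.
    by move=> /set2P[g1 | -> //]; move: (refl_neq1 Tg); rewrite g1 eqxx.
  split=> //; have gb : g != b by apply: contraNneq Kb => <-.
  have chiDE : [set g; b] = chi D.
    by apply/eqP; rewrite eqEcard subUset !sub1set Dchig chib cards2 gb.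
  have Tb := subsetP (chi_subT sDW) _ chib.
  have [-> // | tb] := eqVneq t b.
  have : len S b < len S t.
    apply: (@canonical_pair_len g); rewrite ?chiDE ?genD ?refl_neq1 //.
    by apply: contraNneq Kt => ->.
  (* Since t lies in the group generated by g and b, the shorter b could replace t, against
     minimality. *)
  have sbW : b |: G \subset W by rewrite subUset sub1set memTW.
  have bGt : t \in <<b |: G>>.
    apply: subsetP Dt; rewrite -genD -chiDE gen_subG subUset !sub1set.
    by rewrite !mem_gen ?setU11 // inE Gg orbT.
  rewrite ltnNge => /negP[]; apply: min_t; rewrite /P Tb eqEsubset gen_subG sbW.
  rewrite -gen_t gen_subG subUset sub1set bGt.
  exact: subset_trans (subsetUr _ _) (subset_gen _).
have defS : t |: chi G = S.
  apply: pairwise_canonical_simple.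
  - by rewrite subUset sub1set Tt chi_subT.
  - rewrite -gen_t; apply/eqP; rewrite eqEsubset genS ?setUS ?chi_sub //=.
    rewrite gen_subG subUset sub1set mem_gen ?setU11 //=.
    by rewrite -{1}(gen_chi sRT genR) genS ?subsetUr.
  have can_gt g : g \in chi G -> canonical [set g; t].
    move=> chig; have [chiDg chiDt] := can_t g chig.
    apply: (@canonical_sub_chi <<[set g; t]>>%G).
      rewrite gen_subG; apply/subsetP=> x /set2P[]->; apply: memTW => //.
      exact: subsetP (chi_subT sGW) _ chig.
    by apply/subsetP=> x /set2P[]->.
  move=> x y /setU1P[-> | chix] /setU1P[-> | chiy] xy.
  - by rewrite eqxx in xy.
  - by rewrite setUC; apply: can_gt.
  - exact: can_gt.
  - by apply: canonical_sub_chi sGW _; apply/subsetP=> z /set2P[]->.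
by rewrite -defS subsetUr.
Qed.
End Reflections.

(** * Parabolic closure of a list of reflections and conclusion *)

Lemma refls_sub_parabolic (gT : finGroupType) (W : {group gT}) (S : {set gT})
    (ts : seq gT) :
  coxeter_system W S -> {subset ts <= class_support S W} ->
  exists S' (K : {set gT}),
    [/\ coxeter_system W S', class_support S' W = class_support S W,
        #|S'| = #|S|, K \subset S' /\ #|K| <= size ts
      & {subset ts <= <<K>>}].
Proof.
move=> cox; elim: ts => [|t ts IHts] tsT.
  by exists S, set0; rewrite sub0set cards0.
have [|S' [K [cox' TE cardS' [sKS' cardK] tsK]]] := IHts.
  by move=> x xts; apply: tsT; rewrite inE xts orbT.
have [nu [nuM nuS]] := inversion_cocycle_ex cox'.
have Tt : t \in class_support S' W by rewrite TE tsT // inE eqxx.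
(* Each further reflection enlarges K by at most one element, at the price of conjugating the simple
   system, which preserves the set of reflections. *)
have [u [L [Wu sLS cardL sKL Lt]]] := parabolic_step cox' nuM nuS sKS' Tt.
exists (S' :^ u), L; split=> //.
- exact: coxeter_systemJ.
- by rewrite class_supportGidl.
- by rewrite cardJg.
- by split=> //; apply: leq_trans cardL _.
by move=> x /predU1P[-> // | /tsK]; apply/subsetP/genS.
Qed.

Lemma parabolic_simple_subset (gT : finGroupType) (W : {group gT})
    (T S P : {set gT}) :
  simple_system W T S -> P \subset S -> parabolic W T <<P>>.
Proof.
move=> simS sPS; exists (enum P ++ enum (S :\: P)), #|P|.
have sE : [set x in enum P ++ enum (S :\: P)] = S.
  apply/setP=> x; rewrite inE mem_cat !mem_enum inE.
  by have [Px | ] := boolP (x \in P); rewrite // (subsetP sPS).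
split; rewrite ?sE //.
- rewrite cat_uniq !enum_uniq andbT /=; apply/hasPn=> x.
  by rewrite !mem_enum inE => /andP[].
- by rewrite size_cat -cardE leq_addr.
by rewrite cardE take_size_cat // set_enum.
Qed.

Theorem theorem1p5 (gT : finGroupType) (W : {group gT}) (T : {set gT})
    (n : nat) (w : gT) (t : n.-tuple gT) :
  dual_coxeter_system W T n ->
  quasi_coxeter W T n w ->
  Red T w t ->
  <<[set x in t]>> = W ->
  parabolic W T <<[set x in take n.-1 t]>>.
Proof.
case=> S0 [_ cardS0 cox0 TE] _ [[tT _] _] gen_t.
set R := [set x in take n.-1 t].
have takeT : {subset take n.-1 t <= class_support S0 W}.
  by move=> x /mem_take/tT; rewrite TE.
have [S [K [cox TE' cardS [sKS cardK] RK]]] := refls_sub_parabolic cox0 takeT.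
have sST : S \subset T by rewrite TE -TE' sub_class_support.
have sRT : R \subset class_support S W.
  by rewrite TE'; apply/subsetP=> x; rewrite inE => /takeT.
have [nu [nuM nuS]] := inversion_cocycle_ex cox.
rewrite -(gen_chi (G := <<R>>%G) cox nuM nuS sRT) //.
apply: parabolic_simple_subset (conj sST cox) _.
(* In rank 0 the set S is empty and there are no reflections; otherwise the n entries before the
   last one of t leave K smaller than S. *)
case: n => [|n] in t cardS0 gen_t @R takeT cardK RK sRT tT *.
  move/eqP: cardS; rewrite cardS0 cards_eq0 => /eqP S_0.
  have chiT := chi_subT cox nuM nuS (G := <<_>>%G) (gen_subW cox sRT).
  apply/subsetP=> x /(subsetP chiT).
  by case/reflP=> s [y []]; rewrite S_0 inE.
rewrite size_takel ?size_tuple // in cardK.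
pose tn := tnth t ord_max.
apply: (chi_simple cox nuM nuS (R := R) (K := K) (t := tn)) => //.
- by rewrite TE' -TE tT // mem_tnth.
- by rewrite properEcard sKS cardS cardS0 ltnS.
- by rewrite gen_subG; apply/subsetP=> x; rewrite inE => /RK.
have tE : t = rcons (take n t) tn :> seq gT.
  rewrite -{1}(take_size t) size_tuple (take_nth tn) ?size_tuple //.
  by congr rcons; rewrite -[RHS]/(tnth t ord_max) (tnth_nth tn).
have setE : [set x in t] = tn |: R.
  apply/setP=> x; rewrite (_ : (x \in _) = (x \in rcons (take n t) tn)).
    by rewrite mem_rcons !inE.
  by rewrite inE -tE.
rewrite -gen_t setE; apply/eqP; rewrite eqEsubset gen_subG subUset sub1set.
by rewrite mem_gen ?setU11 ?genS ?subsetUr ?setUS ?subset_gen.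
Qed.
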